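(* For every integer $n\ge1$, the image-size polynomial $M_n(t)=\sum_{\mathbf w\in\mathrm{PF}_n}t^{|\mathrm{im}(\mathbf w)|-1}$ satisfies $$M_n(t)=\sum_{j=0}^{n-1}\binom nj\left\{\begin{matrix}n\\ j+1\end{matrix}\right\}j!\,t^j.$$ Moreover, $M_n(t)$ has $n-1$ simple zeros, all of which are negative (real).
   Context: A parking function of length $n$ is a word $\mathbf w=(w_1,\dots,w_n)\in[n]^n$, $[n]=\{1,\dots,n\}$, whose nondecreasing rearrangement $b_1\le\dots\le b_n$ satisfies $b_i\le i$ for all $i$; $\mathrm{PF}_n$ is the set of these. $\mathrm{im}(\mathbf w)=\{w_1,\dots,w_n\}$ is the set of distinct letters of $\mathbf w$. $\left\{\begin{matrix}n\\ k\end{matrix}\right\}$ is the Stirling number of the second kind, the number of partitions of $[n]$ into $k$ nonempty blocks. *)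

(* Defs.v *)
From mathcomp Require Import all_boot all_order all_algebra.
From mathcomp Require Import complex reals.

Set Implicit Arguments.
Unset Strict Implicit.
Unset Printing Implicit Defensive.

Import Order.TTheory GRing.Theory Num.Theory.

(* A word of length n over [n] = {1, ..., n} is an n.-tuple 'I_n, the element
   x : 'I_n standing for the letter x + 1. *)
Definition letters (n : nat) (w : n.-tuple 'I_n) : seq nat :=
  [seq (x : nat).+1 | x : 'I_n <- w].

(* nth is 0-based: entry i of the sorted word is b_{i+1}. *)
Definition is_parking (n : nat) (w : n.-tuple 'I_n) : bool :=
  [forall i : 'I_n, nth 0 (sort leq (letters w)) i <= i.+1].

Definition PF (n : nat) : {set n.-tuple 'I_n} := [set w | is_parking w].

Definition im (n : nat) (w : n.-tuple 'I_n) : {set 'I_n} := [set x in w].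

Definition stirling2 (n k : nat) : nat :=
  #|[set P : {set {set 'I_n}} | partition P [set: 'I_n] & #|P| == k]|.

Local Open Scope ring_scope.

Definition image_size_poly (n : nat) : {poly int} :=
  \sum_(w in PF n) 'X^(#|im w| - 1).

(* Main.v *)
(* Counting.  Classifying words of length n over a set of size N by their kernel
   partition, S(n, k) N(N-1)...(N-k+1) of them have k distinct letters; comparing
   with a letter-by-letter count gives the recurrence of S(n, k).  By Pollak's
   circle argument each class of words over Z/(n+1), modulo adding a constant to
   all letters, contains exactly one parking function, and shifting preserves the
   image size.

   Zeros.  If f has a zero of order m >= 1 at 0, k simple negative zeros and no
   other, then for r > 0 the polynomial r f + f' has a zero of order m - 1 at 0,
   k + 1 simple negative zeros and no other.  Applied to the Touchard polynomials
   T_(n+1) = X (T_n + T_n'), it shows that P = T_n / X has n - 1 simple negative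
   zeros.  So P(d/dx) is a product of n - 1 operators d/dx + r with r > 0, and the
   same step, repeated n - 1 times from x^n, shows that P(d/dx) x^n = x^n M_n(1/x) has n - 1
   simple negative zeros. *)
Require Import Defs.
From mathcomp Require Import all_boot all_order all_algebra.
From mathcomp Require Import complex reals polyrcf.
From mathcomp Require Import zify ring lra.

Set Implicit Arguments.
Unset Strict Implicit.
Unset Printing Implicit Defensive.

Import Order.TTheory GRing.Theory Num.Theory.

(** * Words and set partitions *)

Section Kernel.
Variables (n : nat) (T : finType).
Implicit Types (w : n.-tuple T) (P : {set {set 'I_n}}).

Definition ker_part w : {set {set 'I_n}} :=
  [set [set j | tnth w j == tnth w i] | i : 'I_n].

Lemma ker_partP w : partition (ker_part w) [set: 'I_n].
Proof.
apply/and3P; split.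
- apply/eqP/setP => i; rewrite inE; apply/bigcupP.
  by exists [set j | tnth w j == tnth w i]; rewrite ?imset_f // inE.
- apply/trivIsetP => _ _ /imsetP[i _ ->] /imsetP[j _ ->] neq.
  rewrite -setI_eq0; apply/eqP/setP => k; rewrite !inE.
  apply/negP => /andP[/eqP ki /eqP kj]; case/eqP: neq.
  by rewrite -ki kj.
- by apply/imsetP => -[i _ /setP/(_ i)]; rewrite !inE eqxx.
Qed.

Lemma card_ker_part w : #|ker_part w| = #|[set x in w]|.
Proof.
have -> : ker_part w = (fun v => [set j | tnth w j == v]) @: [set x in w].
  apply/setP => B; apply/imsetP/imsetP => -[x xin ->].
    by exists (tnth w x); rewrite // inE mem_tnth.
  by move: xin; rewrite inE => /tnthP[i ->]; exists i.
apply: card_in_imset => x y; rewrite !inE => /tnthP[i ->] _ /setP/(_ i).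
by rewrite !inE eqxx => /esym/eqP.
Qed.

(** A word with kernel [P] is constant on each block and differs between blocks, so it amounts to an
    injection from the blocks of [P] into [T]. *)
Lemma card_words_ker P : partition P [set: 'I_n] ->
  #|[set w | ker_part w == P]| = #|T| ^_ #|P|.
Proof.
move=> partP; have [/eqP covP trivP P0] := and3P partP.
have blkP i : pblock P i \in P by apply: pblock_mem; rewrite covP inE.
have blkE B i : B \in P -> i \in B -> pblock P i = B.
  by move=> BP iB; apply: def_pblock.
pose D := {B : {set 'I_n} | B \in P}.
pose blk i : D := Sub (pblock P i) (blkP i).
pose Phi (g : {ffun D -> T}) := [tuple g (blk i) | i < n].
have blk_eq i j : (blk j == blk i) = (j \in pblock P i).
  by rewrite -val_eqE /= eq_sym eq_pblock ?covP ?inE.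
have blk_surj (B : D) : exists i, blk i = B.
  have [i iB] : exists i, i \in val B.
    by apply/set0Pn; apply: contraNneq P0 => <-; apply: (valP B).
  by exists i; apply/val_inj/blkE => //; apply: (valP B).
have -> : [set w | ker_part w == P] = Phi @: [set g : {ffun D -> T} | injectiveb g].
  apply/setP => w; rewrite inE; apply/eqP/imsetP => [kerE | [g]].
    have wE i : pblock P i = [set j | tnth w j == tnth w i].
      by apply: blkE; rewrite ?inE // -kerE imset_f.
    have ex (B : D) : exists i, blk i == B by have [i <-] := blk_surj B; exists i.
    (* [r] picks a position in each block; the letter found there is the value of the injection on
       that block. *)
    pose r B := xchoose (ex B).
    have rK B : blk (r B) = B := eqP (xchooseP (ex B)).
    exists [ffun B => tnth w (r B)].
      rewrite inE; apply/injectiveP => B C; rewrite !ffunE => eqBC.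
      rewrite -(rK B) -(rK C); apply/eqP; rewrite blk_eq wE inE; exact/eqP.
    apply: eq_from_tnth => i; rewrite tnth_mktuple ffunE.
    apply/eqP; rewrite eq_sym; move: (blk_eq i (r (blk i))).
    by rewrite rK eqxx wE inE => <-.
  rewrite inE => /injectiveP gI ->; rewrite /ker_part.
  have kE i : [set j | tnth (Phi g) j == tnth (Phi g) i] = pblock P i.
    by apply/setP => j; rewrite inE !tnth_mktuple (inj_eq gI) blk_eq.
  apply/setP => B; apply/imsetP/idP => [[i _ ->] | BP]; first by rewrite kE.
  have [i /(congr1 val) /= iE] := blk_surj (Sub B BP).
  by exists i => //; rewrite kE.
rewrite card_in_imset => [|g h _ _ eqgh].
  by rewrite card_inj_ffuns card_sig.
apply/ffunP => B; have [i <-] := blk_surj B.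
by have := congr1 (fun w => tnth w i) eqgh; rewrite !tnth_mktuple.
Qed.

Lemma card_words k :
  #|[set w : n.-tuple T | #|[set x in w]| == k]| = stirling2 n k * #|T| ^_ k.
Proof.
rewrite -sum1_card.
rewrite (partition_big ker_part
  (fun P => P \in [set P | partition P [set: 'I_n] & #|P| == k])) /=; last first.
  by move=> w; rewrite !inE ker_partP card_ker_part.
rewrite /stirling2 -sum_nat_const; apply: eq_bigr => P.
rewrite inE => /andP[partP /eqP cardP].
rewrite -cardP -card_words_ker // -sum1_card; apply: eq_bigl => w.
rewrite !inE -card_ker_part.
by case: (ker_part w =P P) => [->|_]; rewrite ?andbF // cardP eqxx.
Qed.

End Kernel.

(** * Letter-by-letter counting and the recurrence of the Stirling numbers *)

Lemma sum_tuple_cons n (T : finType) (F : n.+1.-tuple T -> nat) :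
  \sum_w F w = \sum_(x : T) \sum_(w : n.-tuple T) F [tuple of x :: w].
Proof.
rewrite pair_big /=.
rewrite (reindex (fun p : T * n.-tuple T => [tuple of p.1 :: p.2])) //=.
exists (fun w => (thead w, [tuple of behead w])) => [[x w] _|w _] /=.
  by rewrite theadE; congr pair; apply: val_inj.
by rewrite -tuple_eta.
Qed.

(** The first letter either repeats one of the [k.+1] letters of the tail or is one of the
    [#|T| - k] letters missing from a tail with [k] letters. The truncated subtraction does no harm,
    since no tail has more than [#|T|] letters. *)
Lemma card_words_cons n (T : finType) k :
  #|[set w : n.+1.-tuple T | #|[set x in w]| == k.+1]| =
  k.+1 * #|[set w : n.-tuple T | #|[set x in w]| == k.+1]| +
  (#|T| - k) * #|[set w : n.-tuple T | #|[set x in w]| == k]|.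
Proof.
have cE m j : #|[set w : m.-tuple T | #|[set x in w]| == j]| =
    \sum_(w : m.-tuple T) (#|[set x in w]| == j).
  by rewrite -sum1_card big_mkcond; apply: eq_bigr => w _; rewrite inE; case: eqP.
rewrite !cE sum_tuple_cons exchange_big !big_distrr -big_split /=.
apply: eq_bigr => w _; set A := [set x in w].
have AE x : [set y in [tuple of x :: w]] = x |: A.
  by apply/setP => y; rewrite !inE.
under eq_bigr => x _ do rewrite AE cardsU1.
rewrite (bigID (mem A)) /= (eq_bigr (fun=> (#|A| == k.+1) : nat)); last first.
  by move=> x ->.
rewrite [X in _ + X](eq_bigr (fun=> (#|A| == k) : nat)); last first.
  by move=> x /negPf ->.
rewrite !sum_nat_const -(cardC A).
have -> : #|[pred x | x \notin A]| = #|[predC A]| by apply: eq_card.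
by do 2!case: eqP => [?|?]; lia.
Qed.

(** Over an alphabet of [k.+1] letters every falling factorial involved is (k+1)! and exactly one
    letter is missing from a tail with [k] letters; cancelling (k+1)! leaves the recurrence. *)
Lemma stirling2_recr n k :
  stirling2 n.+1 k.+1 = k.+1 * stirling2 n k.+1 + stirling2 n k.
Proof.
have := @card_words_cons n 'I_k.+1 k; rewrite !card_words card_ord.
rewrite ffactnn; have -> : k.+1 ^_ k = k.+1`!.
  by have := ffactnSr k.+1 k; rewrite ffactnn subSnn muln1.
by have := fact_gt0 k.+1; rewrite subSnn; nia.
Qed.

Lemma stirling2_0n k : stirling2 0 k = (k == 0).
Proof.
have := @card_words 0 'I_k k; rewrite card_ord ffactnn.
have im0 (w : 0.-tuple 'I_k) : [set x in w] = set0.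
  by apply/setP => x; rewrite (tuple0 w) !inE.
have -> : #|[set w : 0.-tuple 'I_k | #|[set x in w]| == k]| = (k == 0).
  rewrite -sum1_card; under eq_bigl => w do rewrite inE im0 cards0 eq_sym.
  by case: eqP => _; rewrite ?big_pred0_eq // sum1_card card_tuple expn0.
have := fact_gt0 k; case: eqP => [->|_]; rewrite ?fact0; nia.
Qed.

Lemma stirling2_gt n k : n < k -> stirling2 n k = 0.
Proof.
elim: n k => [|n IH] [|k] //; first by rewrite stirling2_0n.
by move=> nk; rewrite stirling2_recr !IH // ?muln0 //; apply: ltnW.
Qed.

Lemma stirling2_diag n : stirling2 n n = 1.
Proof.
elim: n => [|n IH]; first by rewrite stirling2_0n.
by rewrite stirling2_recr IH stirling2_gt // muln0.
Qed.

Lemma stirling2_n0 n : 0 < n -> stirling2 n 0 = 0.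
Proof.
move=> n0; apply/eqP; rewrite cards_eq0; apply/eqP/setP => P; rewrite !inE.
apply/negP => /andP[/and3P[/eqP covP _ _]]; rewrite cards_eq0 => /eqP P0.
by have := in_setT (Ordinal n0); rewrite -covP P0 /cover big_set0 inE.
Qed.

(** * Pollak's circle argument *)

Section CycleLemma.
Variable n : nat.
Implicit Types (w : n.-tuple 'I_n.+1) (s : seq 'I_n.+1) (c x : 'I_n.+1).

(** Parking on a circle with spots 0, ..., n, phrased through counts rather than sorting, because
    counts behave well under shifts. *)
Definition cyc_parking w :=
  [forall i : 'I_n.+1, i <= count (fun x : 'I_n.+1 => x < i) w].

Definition cyc_shift c w := [tuple of [seq (x - c)%R | x <- w]].

Lemma val_ord_sub x c :
  (x - c)%R = (if c <= x then x - c else x + n.+1 - c) :> nat.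
Proof.
rewrite /= modnDmr; have := ltn_ord x; have := ltn_ord c; case: (leqP c x) => cx cn xn.
  have -> : x + (n.+1 - c) = x - c + n.+1 by lia.
  by rewrite modnDr modn_small //; lia.
by rewrite addnBA ?modn_small //; lia.
Qed.

(** The letters x with x - c < i fill the cyclic interval of length i starting at c, which here does
    not wrap past n. *)
Lemma count_shift_small c s i : c + i <= n.+1 ->
  count (fun x => (x - c)%R < i) s + count (fun x : 'I_n.+1 => x < c) s =
  count (fun x : 'I_n.+1 => x < c + i) s.
Proof.
move=> ci; rewrite (@eq_count _ _ (fun x : 'I_n.+1 =>
  (if c <= x then x - c else x + n.+1 - c) < i)) => [|x]; last by rewrite val_ord_sub.
have := ltn_ord c; elim: s => //= x s IH cn; rewrite -IH //; have := ltn_ord x.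
by case: (leqP c x); lia.
Qed.

(** Here the interval wraps: it consists of the letters from c to n and those below c + i - (n +
    1). *)
Lemma count_shift_large c s i : i <= n.+1 <= c + i ->
  count (fun x => (x - c)%R < i) s + count (fun x : 'I_n.+1 => x < c) s =
  size s + count (fun x : 'I_n.+1 => x < c + i - n.+1) s.
Proof.
move=> ci; rewrite (@eq_count _ _ (fun x : 'I_n.+1 =>
  (if c <= x then x - c else x + n.+1 - c) < i)) => [|x]; last by rewrite val_ord_sub.
have := ltn_ord c; elim: s => [|x s IH] cn /=; first lia; have := IH cn; have := ltn_ord x.
by case: (leqP c x); lia.
Qed.

(* The shifts that park are the minimizers of [count (< j) - j]; the last
   summand breaks ties towards the smallest [j], which makes them unique. *)
Definition excess w (j : 'I_n.+1) :=
  (count (fun x : 'I_n.+1 => x < j) w + n - j) * n.+1 + j.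

Lemma excess_inj w : injective (excess w).
Proof.
move=> i j /(congr1 (modn^~ n.+1)); rewrite /excess !modnMDl !modn_small //.
exact: val_inj.
Qed.

(** The comparison is lexicographic, [j] being the last digit in base n + 1: against a smaller [j],
    the leading digit of [c] must be strictly smaller. Adding n keeps the subtraction from being
    truncated. *)
Lemma excess_le w c j : (excess w c <= excess w j) =
  (count (fun x : 'I_n.+1 => x < c) w + n - c + (j < c) <=
   count (fun x : 'I_n.+1 => x < j) w + n - j).
Proof.
rewrite /excess; have := ltn_ord j; have := ltn_ord c.
set a := (_ - c)%N; set b := (_ - j)%N.
move=> cn jn; case: (ltngtP a b) => ab; case: ltnP => jc; apply/idP/idP; nia.
Qed.

(** The shift by [c] parks when each cyclic interval starting at [c] holds at least as many letters
    as its length. The interval ending just before [j] gives the comparison with [j]. If [j < c] it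
    wraps, and the full turn, with n letters for n + 1 spots, costs the 1 that makes the inequality
    strict. *)
Lemma cyc_parking_shift w c :
  cyc_parking (cyc_shift c w) = [forall j, excess w c <= excess w j].
Proof.
have cn := ltn_ord c; have sz := size_tuple w.
pose cnt i := count (fun x => (x - c)%R < i) w.
have cntE i : count (fun x : 'I_n.+1 => x < i) (cyc_shift c w) = cnt i.
  by rewrite count_map.
have small i : c + i <= n.+1 ->
    cnt i + count (fun x : 'I_n.+1 => x < c) w = count (fun x : 'I_n.+1 => x < c + i) w.
  exact: count_shift_small.
have large i : i <= n.+1 <= c + i ->
    cnt i + count (fun x : 'I_n.+1 => x < c) w =
    n + count (fun x : 'I_n.+1 => x < c + i - n.+1) w.
  by have := @count_shift_large c w i; rewrite sz.
apply/forallP/forallP => H i; have iN := ltn_ord i.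
  have {}H k : k < n.+1 -> k <= cnt k.
    by move=> kn; have := H (Ordinal kn); rewrite cntE.
  rewrite excess_le; case: (ltnP i c) => ic.
    have := large (i + n.+1 - c) ltac:(lia); have := H (i + n.+1 - c) ltac:(lia).
    by rewrite (_ : c + (i + n.+1 - c) - n.+1 = i); lia.
  have := small (i - c) ltac:(lia); have := H (i - c) ltac:(lia).
  by rewrite (_ : c + (i - c) = i); lia.
rewrite cntE; case: (leqP (c + i) n) => ci.
  have := H (Ordinal (ci : c + i < n.+1)); rewrite excess_le /=.
  by have := small i ltac:(lia); lia.
have lt : c + i - n.+1 < n.+1 by lia.
have := H (Ordinal lt); rewrite excess_le /=.
by have := large i ltac:(lia); lia.
Qed.

Lemma card_cyc_parking_shift w : #|[set c | cyc_parking (cyc_shift c w)]| = 1.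
Proof.
have [c _ cmin] := @arg_minnP _ ord0 predT (excess w) isT.
have -> : [set c | cyc_parking (cyc_shift c w)] = [set c]; last by rewrite cards1.
apply/setP => d; rewrite !inE cyc_parking_shift.
apply/forallP/eqP => [dmin | -> j]; last exact: cmin.
by apply: (@excess_inj w); apply/eqP; rewrite eqn_leq dmin cmin.
Qed.

(** Double counting of the pairs (c, w) for which the shift of w by c parks: each w has exactly one
    such c, and for fixed c shifting permutes the words and keeps the image size. *)
Lemma card_cyc_parking k :
  n.+1 * #|[set w | cyc_parking w & #|[set x in w]| == k]| =
  #|[set w : n.-tuple 'I_n.+1 | #|[set x in w]| == k]|.
Proof.
have imS c w : #|[set x in cyc_shift c w]| = #|[set x in w]|.
  rewrite -(card_imset _ (addIr (- c)%R)); apply: eq_card => y.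
  rewrite inE; apply/mapP/imsetP => -[x xw ->]; exists x => //.
    by rewrite inE.
  by rewrite inE in xw.
have shiftK c : cancel (cyc_shift c) (cyc_shift (- c)%R).
  move=> w; apply: eq_from_tnth => i; rewrite !tnth_map.
  by rewrite opprK subrK.
rewrite -[RHS]sum1_card.
under [RHS]eq_bigr => w _ do rewrite -(card_cyc_parking_shift w) -sum1_card big_mkcond.
rewrite exchange_big /= -{1}(card_ord n.+1) -sum_nat_const.
apply: eq_bigr => c _; rewrite -big_mkcondr /= -sum1_card.
rewrite (reindex (cyc_shift c)) /=; last first.
  exists (cyc_shift (- c)%R) => w _; first exact: shiftK.
  by rewrite -{2}[w](shiftK (- c)%R) opprK.
by apply: eq_bigl => w; rewrite !inE imS andbC.
Qed.

End CycleLemma.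

(** * From the circle back to parking functions *)

(** In sorted order, the i-th entry is at most i exactly when at least i entries are at most i. A
    letter at most i is stored as a value below [i], and the instance [i = 0] is vacuous. *)
Lemma is_parkingE n (w : n.-tuple 'I_n) : 0 < n ->
  is_parking w = [forall i : 'I_n.+1, i <= count (fun x : 'I_n => x < i) w].
Proof.
move=> n0; rewrite /is_parking; set b := sort _ _.
have sb : sorted leq b by apply: sort_sorted; exact: leq_total.
have szb : size b = n by rewrite size_sort size_map size_tuple.
have cb i : count (fun x : 'I_n => x < i) w = count (fun x => x <= i) b.
  by rewrite count_sort count_map; apply: eq_count.
apply/forallP/forallP => H i.
  rewrite cb; case: i => -[|i] //= iN.
  have iN' : i < n by [].
  have := H (Ordinal iN') => /= bi.
  suff: size (take i.+1 b) <= count (fun x => x <= i.+1) b by rewrite size_takel ?szb.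
  rewrite -[in X in _ <= X](cat_take_drop i.+1 b) count_cat.
  apply: leq_trans (leq_addr _ _); rewrite leq_eqVlt; apply/orP; left.
  rewrite eq_sym -all_count; apply/(all_nthP 0) => j.
  rewrite size_takel ?szb // => ji; rewrite nth_take //.
  apply: leq_trans bi; apply: (sorted_leq_nth leq_trans leqnn) => //.
  - by rewrite inE szb (leq_trans ji).
  - by rewrite inE szb.
have := H (lift ord0 i); rewrite cb lift0.
exact: (@Order.PreorderTheory.nth_count_le _ nat i.+1 0 b i sb).
Qed.

(** The instance i = n of the circle condition says that all n letters avoid the extra spot n, so
    circle-parking words are words over ['I_n]. *)
Lemma card_PF_im n k : 0 < n ->
  #|[set w in PF n | #|im w| == k]| =
  #|[set w : n.-tuple 'I_n.+1 | cyc_parking w & #|[set x in w]| == k]|.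
Proof.
move=> n0; pose up (w : n.-tuple 'I_n) := map_tuple (widen_ord (leqnSn n)) w.
have widI : injective (widen_ord (leqnSn n)).
  by move=> x y /(congr1 val) /= /val_inj.
have upI : injective up.
  by move=> v w /(congr1 val) /(inj_map widI) /val_inj.
have parkE w : cyc_parking (up w) = is_parking w.
  by rewrite is_parkingE //; apply: eq_forallb => i; rewrite count_map.
have imE w : #|[set x in up w]| = #|im w|.
  rewrite /im -(card_imset _ widI); apply: eq_card => y.
  rewrite inE; apply/mapP/imsetP => -[x xw ->]; exists x => //.
    by rewrite inE.
  by rewrite inE in xw.
rewrite -(card_imset _ upI); apply: eq_card => w.
apply/imsetP/idP => [[v]|].
  by rewrite !inE => /andP[vP vk] ->; rewrite parkE vP imE.
rewrite inE => /andP[wP wk].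
have ltw i : tnth w i < n.
  have /forallP/(_ ord_max) /= := wP.
  rewrite -{1}(size_tuple w) => cw.
  have /allP : all (fun x : 'I_n.+1 => x < n) w by rewrite all_count eqn_leq count_size cw.
  by apply; exact: mem_tnth.
pose v := [tuple Ordinal (ltw i) | i < n].
have vE : w = up v.
  by apply: eq_from_tnth => i; rewrite tnth_map tnth_mktuple; apply: val_inj.
by exists v => //; rewrite !inE -parkE -imE -vE wP.
Qed.

Lemma card_PF_im_eq n k : 0 < n ->
  #|[set w in PF n | #|im w| == k.+1]| = 'C(n, k) * stirling2 n k.+1 * k`!.
Proof.
move=> n0; apply/eqP; rewrite card_PF_im // -(eqn_pmul2l (ltn0Sn n)).
(* The factor n + 1 of the falling factorial cancels, and the rest of it is C(n, k) k!. *)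
rewrite card_cyc_parking card_words card_ord ffactSS -bin_ffact.
by apply/eqP; ring.
Qed.

Local Open Scope ring_scope.

Lemma image_size_polyE n : (0 < n)%N ->
  image_size_poly n =
    \sum_(0 <= j < n) ('C(n, j) * stirling2 n j.+1 * j`!)%N%:Z *: 'X^j.
Proof.
move=> n0; rewrite /image_size_poly big_mkord.
(* The image is nonempty, so the exponent [#|im w| - 1] is not truncated. *)
have im_gt0 (w : n.-tuple 'I_n) : (0 < #|im w| <= n)%N.
  rewrite [X in _ && X](leq_trans (max_card _)) ?card_ord // andbT.
  apply/card_gt0P; exists (tnth w (Ordinal n0)).
  by rewrite inE mem_tnth.
have lt (w : n.-tuple 'I_n) : (#|im w| - 1 < n)%N by have := im_gt0 w; lia.
rewrite (partition_big (fun w => Ordinal (lt w)) predT) //=.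
apply: eq_bigr => j _; rewrite -card_PF_im_eq //.
rewrite (eq_bigr (fun=> 'X^j)) => [|w /andP[_ /eqP <-] //].
rewrite big_const iter_addr addr0 -natz scaler_nat; congr (_ *+ _).
apply: eq_card => w; rewrite !inE; congr (_ && _); first by rewrite inE.
rewrite -(inj_eq val_inj) /=; have := im_gt0 w.
by case: #|im w| => // c _; rewrite subn1 eqSS.
Qed.

(** * Real-rootedness *)

Section RealRooted.
Variable R : rcfType.
Implicit Types (p f h : {poly R}) (s t : seq R).

Local Notation "\Pi s" := (\prod_(z <- s) ('X - z%:P)) (at level 10).

(** The intermediate value theorem gives one root strictly inside each gap of the path. *)
Lemma sign_changes_roots h a t :
  path (fun x y => (x < y) && (h.[x] * h.[y] < 0)) a t ->
  exists s, [/\ path <%R a s, size s = size t, all (root h) s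
             & all (fun z => z < last a t) s].
Proof.
elim: t a => [|b t IH] a /=; first by exists [::].
case/andP=> /andP[ab hab] bt.
have [s [bs sz rs ls]] := IH b bt.
have [z] := poly_ivtoo (ltW ab) hab.
rewrite in_itv /= => /andP[az zb] rz.
exists (z :: s); split=> /=; rewrite ?az ?sz ?rz ?ls ?andbT //.
  by case: s bs {sz rs ls} => //= c s /andP[bc ->]; rewrite (lt_trans zb).
apply: lt_le_trans zb _; case: t bt {IH sz ls} => //= c t /andP[/andP[bc _] ct].
have /lt_path_min/allP := sub_path (fun x y => @proj1 _ _ \o andP) ct.
by move=> min; case/lastP: t min {ct} => [|t d] min; rewrite ?(ltW bc) // last_rcons
   (ltW (lt_trans bc _)) // min // mem_rcons mem_head.
Qed.

Lemma horner_prod_XsubC_mul_gt0 s a b : (forall z, z \in s -> 0 < (a - z) * (b - z)) ->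
  0 < (\Pi s).[a] * (\Pi s).[b].
Proof.
move=> H; rewrite !horner_prod -big_split /= big_seq.
by apply: prodr_gt0 => z /H; rewrite !hornerXsubC.
Qed.

(** For consecutive roots a < b, write the product as (X - a)(X - b)u. Its derivative is (a - b)u(a)
    at a and (b - a)u(b) at b, and u keeps its sign on [a, b], having no root there. *)
Lemma deriv_prod_XsubC_alternate s i : sorted <%R s -> (i.+1 < size s)%N ->
  (\Pi s)^`().[s`_i] * (\Pi s)^`().[s`_i.+1] < 0.
Proof.
move=> ss lti; set a := s`_i; set b := s`_i.+1.
have ab : a < b by apply: (sortedP _ ss).
have nth_lt j k : (j < k)%N -> (k < size s)%N -> s`_j < s`_k.
  by move=> jk ks; rewrite (lt_sorted_ltn_nth 0 ss) // inE (ltn_trans jk).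
pose u := take i s ++ drop i.+2 s.
have sE : perm_eq s [:: a, b & u].
  rewrite -{1}(cat_take_drop i s) (drop_nth 0) 1?ltnW // (drop_nth 0 lti).
  by rewrite -/a -/b (perm_catCA _ [:: a; b]).
have pE : \Pi s = ('X - a%:P) * (('X - b%:P) * \Pi u).
  by rewrite (perm_big _ sE) /= !big_cons.
have -> : (\Pi s)^`().[a] = (a - b) * (\Pi u).[a].
  by rewrite pE derivM derivXsubC mul1r hornerD !hornerM !hornerXsubC subrr mul0r addr0.
have -> : (\Pi s)^`().[b] = (b - a) * (\Pi u).[b].
  rewrite pE derivM derivM !derivXsubC !mul1r hornerD hornerM hornerD.
  by rewrite !(hornerXsubC, hornerE) subrr !mul0r ?add0r ?addr0; ring.
have q0 : 0 < (\Pi u).[a] * (\Pi u).[b].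
  apply: horner_prod_XsubC_mul_gt0 => z; rewrite mem_cat => /orP[] zin.
    have za : z < a.
      have [j jl <-] := nthP 0 zin; rewrite size_take in jl.
      have ji : (j < i)%N by move: jl; case: ifP; lia.
      by rewrite nth_take // nth_lt //; lia.
    by rewrite mulr_gt0 // subr_gt0 // (lt_trans za).
  have bz : b < z.
    have [j jl <-] := nthP 0 zin; rewrite size_drop in jl.
    by rewrite nth_drop; apply: nth_lt; rewrite ?leq_addr -?ltn_subRL.
  by rewrite nmulr_rgt0 subr_lt0 // (lt_trans ab).
rewrite -subr_gt0 in ab; set x := (\Pi u).[a] in q0 *; set y := (\Pi u).[b] in q0 *.
have -> : (a - b) * x * ((b - a) * y) = - ((b - a) ^+ 2 * (x * y)) by ring.
by rewrite oppr_lt0 mulr_gt0 // exprn_gt0.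
Qed.

(** At the smallest root [a] the derivative is the product of the negative factors a - z over the
    other roots z. *)
Lemma deriv_prod_XsubC_head a s : path <%R a s ->
  0 < (-1) ^+ size s * (\Pi (a :: s))^`().[a].
Proof.
move=> /lt_path_min/allP mins.
rewrite big_cons derivM derivXsubC mul1r hornerD !hornerM hornerXsubC subrr mul0r addr0.
rewrite horner_prod; elim: s mins => [|b s IH] mins; first by rewrite big_nil mulr1 ltr01.
rewrite big_cons hornerXsubC /= exprS mulrACA mulr_gt0 //.
  by rewrite mulN1r opprB subr_gt0 mins ?mem_head.
by apply: IH => z zs; rewrite mins // inE zs orbT.
Qed.

(** To the left of minus the Cauchy bound, [p] has the sign of its leading term. *)
Lemma exists_sgp_minfty p a : p != 0 ->
  exists2 c, c < a & 0 < (-1) ^+ (size p).-1 * lead_coef p * p.[c].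
Proof.
move=> p0; pose c := Num.min (a - 1) (- cauchy_bound p).
exists c; first by rewrite gt_min ltrBlDr ltrDl ltr01.
have cin : c \in `]-oo, - cauchy_bound p] by rewrite in_itv /= ge_min lexx orbT.
have := sgp_minftyP (le_cauchy_bound p0) cin.
have rc := le_cauchy_bound p0 cin.
rewrite /sgp_minfty => E; rewrite -sgr_cp0 sgrM E -expr2 sqr_sg.
by rewrite mulf_neq0 ?signr_eq0 ?lead_coef_eq0.
Qed.

(* [m] is the multiplicity of the root 0 of [f = 'X^m * \Pi s]; after
   division by ['X^(m-1)], [r *: f + f^`()] is the left-hand side. *)
Lemma real_roots_deriv_step s (m r : R) :
    sorted <%R s -> all (fun z => z < 0) s -> 0 < m -> 0 < r ->
  exists s', [/\ sorted <%R s', all (fun z => z < 0) s', size s' = (size s).+1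
    & m *: \Pi s + 'X * (\Pi s)^`() + r *: ('X * \Pi s) = r *: \Pi s'].
Proof.
move=> ss sneg m0 r0; set p := \Pi s; pose h := m *: p + 'X * p^`() + r *: ('X * p).
have szp : size p = (size s).+1 by rewrite size_prod_XsubC.
have monp : p \is monic := monic_prod_XsubC _ _ _.
have p0 : p != 0 := monic_neq0 monp.
have szXp : size (r *: ('X * p)) = (size s).+2.
  by rewrite size_scale ?gt_eqF // mulrC size_mulX // szp.
have ltsz : (size (m *: p + 'X * p^`())%R < size (r *: ('X * p))%R)%N.
  rewrite szXp ltnS (leq_trans (size_polyD _ _)) // geq_max.
  rewrite (leq_trans (size_scale_leq _ _)) ?szp //=.
  have [->|d0] := eqVneq p^`() 0; first by rewrite mulr0 size_poly0.
  by rewrite mulrC size_mulX // -szp lt_size_deriv.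
have szh : size h = (size s).+2 by rewrite /h addrC size_polyDl.
have lch : lead_coef h = r.
  rewrite /h lead_coefDr // lead_coefZ (mulrC 'X) lead_coefMX.
  by rewrite (monicP monp) mulr1.
pose t := rcons s 0.
have tsort : sorted <%R t.
  rewrite /t; case: (s) ss sneg => //= a u; rewrite rcons_path => -> /andP[a0 /allP u0] /=.
  by case/lastP: u u0 => //= u b u0; rewrite last_rcons u0 // mem_rcons mem_head.
have tE : \Pi t = 'X * p by rewrite /t -cats1 big_cat /= big_seq1 subr0 mulrC.
(* At every root of X p, [h] is a positive multiple of (X p)': the factor is m at 0 and 1 at the
   roots of p. Hence [h] alternates in sign along [t]. *)
have hE z : z \in t -> exists2 k, 0 < k & h.[z] = k * (\Pi t)^`().[z].
  rewrite tE derivM derivX mul1r mem_rcons inE => /predU1P[->|zs].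
    by exists m; rewrite // /h !hornerE /= !hornerE; ring.
  exists 1; rewrite // /h !hornerE /=.
  have /eqP -> : root p z by rewrite root_prod_XsubC.
  by rewrite !mulr0; ring.
have szt : size t = (size s).+1 by rewrite size_rcons.
have h0 : h != 0 by rewrite -size_poly_gt0 szh.
(* A point left of [t] supplies the one missing sign change: [c :: t] has [(size s).+1] gaps, which
   is the degree of [h]. *)
have [c ct hc] := exists_sgp_minfty t`_0 h0.
have alt : path (fun x y => (x < y) && (h.[x] * h.[y] < 0)) c t.
  case tc : t szt => [//|a u] /= [szu]; rewrite tc /= in ct.
  have [k k0 hk] := hE a ltac:(by rewrite tc mem_head).
  apply/andP; split; first rewrite ct /=.
    have := @deriv_prod_XsubC_head a u; rewrite tc /= in tsort => /(_ tsort) d.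
    move: hc; rewrite szh lch -szu /= exprS.
    rewrite hk tc.
    set D := _^`().[a] in d *; set e := (-1) ^+ _ in d * => hc.
    have ee : e * e = 1 by rewrite -expr2 sqrr_sign.
    have hc' : e * h.[c] < 0 by nra.
    have -> : h.[c] * (k * D) = k * ((e * h.[c]) * (e * D)).
      by rewrite mulrACA ee; ring.
    by rewrite pmulr_rlt0 // nmulr_rlt0.
  rewrite -/(sorted _ (a :: u)) -tc; apply/(sortedP 0) => i lti.
  have -> /= : t`_i < t`_i.+1 by apply: (sortedP _ tsort).
  have [k1 k10 ->] := hE t`_i (mem_nth _ (ltnW lti)).
  have [k2 k20 ->] := hE t`_i.+1 (mem_nth _ lti).
  by rewrite mulrACA pmulr_rlt0 ?mulr_gt0 // deriv_prod_XsubC_alternate.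
have [s' [cs' szs' rs' ls']] := sign_changes_roots alt.
have ss' : sorted <%R s' by exact: path_sorted cs'.
exists s'; split=> //.
- by apply: sub_all ls' => z; rewrite /t last_rcons.
- by rewrite szs' szt.
rewrite -/h -lch; apply: all_roots_prod_XsubC; rewrite ?szh ?szs' ?szt //.
by rewrite uniq_rootsE lt_sorted_uniq.
Qed.

(** * Constant-coefficient operators: [diff_op p f] is p(d/dx) f *)

Definition diff_op p f := \sum_(i < size p) p`_i *: f^`(i).

Lemma diff_op_widen N p f : (size p <= N)%N ->
  diff_op p f = \sum_(i < N) p`_i *: f^`(i).
Proof.
move=> le; rewrite /diff_op (big_ord_widen _ (fun i => p`_i *: f^`(i)) le).
rewrite big_mkcond; apply: eq_bigr => i _; case: ltnP => // ip.
by rewrite nth_default // scale0r.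
Qed.

Lemma diff_op_mulXsubC a p f :
  diff_op (('X - a%:P) * p) f = (diff_op p f)^`() - a *: diff_op p f.
Proof.
rewrite (@diff_op_widen (size p).+1 (_ * p)); last first.
  by rewrite (leq_trans (size_polyMleq _ _)) // size_XsubC.
have -> : (diff_op p f)^`() = \sum_(i < (size p).+1) ('X * p)`_i *: f^`(i).
  rewrite big_ord_recl coefXM scale0r add0r raddf_sum.
  by apply: eq_bigr => i _; rewrite coefXM /= derivZ.
rewrite [X in _ - _ *: X](@diff_op_widen (size p).+1) // scaler_sumr -sumrB.
by apply: eq_bigr => i _; rewrite mulrBl coefB coefCM scalerBl scalerA.
Qed.

(** A factor d/dx - a with a < 0 is the derivative step with r = -a: it trades one of the n zeros at
    0 for a new negative zero. The bound [size s <= n] leaves a zero at 0 to spend at every step. *)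
Lemma diff_op_real_roots n s : all (fun z => z < 0) s -> (size s <= n)%N ->
  exists C s', [/\ C != 0, sorted <%R s', all (fun z => z < 0) s', size s' = size s
    & diff_op (\Pi s) 'X^n = C *: ('X^(n - size s) * \Pi s')].
Proof.
elim: s => [|a s IH] /=.
  exists 1, [::]; split=> //; first exact: oner_neq0.
  by rewrite !big_nil /diff_op size_poly1 big_ord1 coefC derivn0 subn0 mulr1 !scale1r.
case/andP=> a0 sneg sn.
have [C [s' [C0 ss' s'neg sz E]]] := IH sneg (ltnW sn).
set k := (n - (size s).+1)%N.
have kE : (n - size s)%N = k.+1 by rewrite /k; lia.
have na0 : 0 < - a by rewrite oppr_gt0.
have [s'' [ss'' s''neg sz'' E'']] :=
  real_roots_deriv_step ss' s'neg (ltr0Sn R k) na0.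
(* Each step multiplies the leading coefficient by r = -a. *)
exists (C * - a), s''; split=> //; first by rewrite mulf_neq0 // gt_eqF.
  by rewrite sz'' sz.
rewrite big_cons diff_op_mulXsubC E kE -scalerA (scalerAr (- a)) -E''.
rewrite derivZ derivM derivXn /= -!mul_polyC exprS -mulr_natr polyC_natr polyCN.
by ring.
Qed.

End RealRooted.

(** * Touchard polynomials and the zeros of the image-size polynomial *)

(** For P_n = T_n / X, the Stirling recurrence reads P_(n+1) = P_n + X P_n' + X P_n, which is the
    derivative step with m = r = 1. *)
Lemma stirling2_poly_roots (R : rcfType) n : (0 < n)%N ->
  exists s : seq R, [/\ sorted <%R s, all (fun z => z < 0) s, size s = n.-1
    & \poly_(j < n) (stirling2 n j.+1)%:R = \prod_(z <- s) ('X - z%:P)].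
Proof.
case: n => // n _; elim: n => [|n [s [ss sneg sz E]]].
  exists [::]; split=> //; rewrite big_nil; apply/polyP => -[|i].
    by rewrite coef_poly coef1 stirling2_diag.
  by rewrite coef_poly coef1.
have [s' [ss' s'neg sz' E']] := real_roots_deriv_step ss sneg ltr01 ltr01.
exists s'; split=> //; first by rewrite sz' sz.
rewrite !scale1r -E in E'; rewrite -E'.
have coefP m i : (\poly_(j < m) (stirling2 m j.+1)%:R)`_i = (stirling2 m i.+1)%:R :> R.
  by rewrite coef_poly; case: ltnP => // mi; rewrite stirling2_gt.
apply/polyP => i; rewrite !coefD !coefXM coef_deriv !coefP stirling2_recr.
case: i => [|i] /=; first by rewrite stirling2_n0 // mul1n addn0 !addr0.
by rewrite natrD mulSn natrD -mulr_natr natrM; ring.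
Qed.

Lemma image_size_poly_roots (R : rcfType) n : (0 < n)%N ->
  exists s : seq R, [/\ uniq s, all (fun z => z < 0) s, size s = (n - 1)%N
    & map_poly intr (image_size_poly n) = n`!%:R *: \prod_(z <- s) ('X - z%:P)].
Proof.
move=> n0; have [s [ss sneg sz sE]] := stirling2_poly_roots R n0.
have szn : (size s <= n)%N by rewrite sz leq_pred.
have [C [s' [C0 ss' s'neg sz' E]]] := diff_op_real_roots sneg szn.
set M := map_poly _ _.
have ME : M = \poly_(j < n) ('C(n, j) * stirling2 n j.+1 * j`!)%:R.
  rewrite /M image_size_polyE // big_mkord.
  rewrite -(poly_def n (fun j => ('C(n, j) * stirling2 n j.+1 * j`!)%N%:Z)); apply/polyP => i.
  by rewrite coef_map !coef_poly /=; case: ltnP.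
(* The top coefficient is C(n, n-1) S(n, n) (n-1)! = n!, which is nonzero and so fixes the degree n
   - 1. *)
have lastE : ('C(n, n.-1) * stirling2 n n.-1.+1 * n.-1`!)%:R = n`!%:R :> R.
  by case: (n) n0 => // m _; rewrite /= binSn stirling2_diag muln1 factS.
have szM : size M = n.
  rewrite ME -[in RHS](prednK n0) -{1}(prednK n0) size_poly_eq // lastE.
  by rewrite pnatr_eq0 -lt0n fact_gt0.
have lcM : lead_coef M = n`!%:R.
  by rewrite lead_coefE szM ME coef_poly ltn_predL n0 lastE.
(* Both sides are [\sum_(j < n) S(n, j+1) n^_j x^(n-j)]. *)
have rev x : x != 0 -> (diff_op (\prod_(z <- s) ('X - z%:P)) 'X^n).[x] = x ^+ n * M.[x^-1].
  move=> x0; rewrite -sE (@diff_op_widen _ n) ?size_poly // ME horner_poly.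
  rewrite horner_sum mulr_sumr; apply: eq_bigr => i _.
  rewrite coef_poly ltn_ord derivnXn hornerZ hornerMn hornerXn -bin_ffact.
  rewrite -mulr_natr !natrM exprVn.
  have -> : x ^+ n = x ^+ (n - i) * x ^+ i by rewrite -exprD subnK // ltnW.
  by field; rewrite expf_neq0.
(* The nonzero zeros of x^n M(1/x) are the inverses of zeros of M; inversion preserves negativity
   and distinctness. *)
exists (map GRing.inv s'); split.
- by rewrite map_inj_uniq ?lt_sorted_uniq //; exact: invr_inj.
- by rewrite all_map; apply: sub_all s'neg => z /=; rewrite invr_lt0.
- by rewrite size_map sz' sz subn1.
rewrite -lcM; apply: all_roots_prod_XsubC.
- by rewrite szM size_map sz' sz prednK.
- rewrite all_map; apply/allP => z zs /=.
  have z0 : z != 0 by rewrite lt_eqF //; apply: (allP s'neg).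
  have /eqP := rev z z0; rewrite E hornerZ hornerM.
  have /eqP -> : root (\prod_(y <- s') ('X - y%:P)) z by rewrite root_prod_XsubC.
  by rewrite !mulr0 eq_sym mulf_eq0 expf_eq0 (negPf z0) andbF.
- by rewrite uniq_rootsE map_inj_uniq ?lt_sorted_uniq //; exact: invr_inj.
Qed.

Theorem theorem9p1 (R : realType) (n : nat) (hn : (1 <= n)%N) :
  image_size_poly n =
    \sum_(0 <= j < n) ('C(n, j) * stirling2 n j.+1 * j`!)%N%:Z *: 'X^j
  /\
  let M : {poly complex R} := map_poly intr (image_size_poly n) in
  exists s : seq R,
    [/\ uniq s,
        size s = (n - 1)%N,
        forall z : complex R, root M z <-> exists2 x : R, x \in s & z = real_complex R x,
        forall x : R, x \in s -> mup (real_complex R x) M = 1%N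
      & forall x : R, x \in s -> x < 0].
Proof.
split; first exact: image_size_polyE.
have [s [us sneg sz sE]] := image_size_poly_roots R hn.
have rcI : injective (real_complex R) by move=> x y [].
(* The factorization over [R] is already complete, so carrying it to the complex numbers leaves no
   room for nonreal zeros, and multiplicities become occurrence counts in the duplicate-free [s]. *)
move=> M; have ME : M = n`!%:R *: \prod_(z <- map (real_complex R) s) ('X - z%:P).
  have -> : M = map_poly (real_complex R) (map_poly intr (image_size_poly n)).
    by rewrite -map_poly_comp; apply: eq_map_poly => x /=; rewrite rmorph_int.
  rewrite sE map_polyZ rmorph_nat rmorph_prod big_map /=; congr (_ *: _).
  by apply: eq_bigr => z _; rewrite map_polyXsubC.
have f0 : n`!%:R != 0 :> complex R by rewrite pnatr_eq0 -lt0n fact_gt0.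
exists s; split=> //.
- move=> z; rewrite ME rootZ // root_prod_XsubC; split.
    by case/mapP=> x xs ->; exists x.
  by case=> x xs ->; apply: map_f.
- move=> x xs; rewrite ME -mul_polyC mupMr ?rootC //.
  by rewrite mu_prod_XsubC count_uniq_mem ?map_inj_uniq // map_f.
- exact/allP.
Qed.
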